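(* Let $p$ be a prime and let $n,K\ge 1$ be integers with $\gcd(n,p)=1$. Put $L=p^{K-1}$, $\widetilde G=\mathbb{Z}_n\times\mathbb{Z}_{p^K}$ and $G=\mathbb{Z}_n\times\mathbb{Z}_L$. Let $P,Q\subset\widetilde G$ satisfy $P\oplus Q=\widetilde G$ and $Q(1,\zeta_p)=0$, where $\zeta_p$ is a primitive $p$-th root of unity. For $0\le r,q\le p-1$ let $$E_r=\{(h,j)\in G:(h,r+pj)\in P\},\qquad C_q=\{(h,j)\in G:(h,q+pj)\in Q\}.$$ Then for each integer $\eta$ the element $$F_\eta(x,y)=\sum_{r=0}^{p-1}y^{\eta r}E_r(x,y)\in \mathbb{Z}[x,y]/(x^n-1,\,y^L-1)$$ is the mask of a subset $D_\eta\subset G$, and $$D_\eta\oplus C_q=G\qquad(0\le q<p).$$ The translated slices $E_r+(0,\eta r)$, $0\le r<p$, are therefore pairwise disjoint subsets of $G$. Moreover, $$D_\eta(x,1)=P(x,1),\qquad Q(x,1)=\sum_{q=0}^{p-1}C_q(x,1)$$ in $\mathbb{Z}[x]/(x^n-1)$. These conclusions include the case $K=1$.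
   Context: $\mathbb{Z}_m=\mathbb{Z}/m\mathbb{Z}$. For subsets $X,Y$ of a finite abelian group $H$, $X\oplus Y=H$ means every element of $H$ has a unique representation $u+v$ with $u\in X$, $v\in Y$. The mask of a subset $E\subset\mathbb{Z}_n\times\mathbb{Z}_m$ is $E(x,t)=\sum_{(h,k)\in E}x^ht^k$, with $h,k$ replaced by their standard representatives in $\{0,\ldots,n-1\}$ and $\{0,\ldots,m-1\}$; it is also regarded as an element of the ring $\mathbb{Z}[x,t]/(x^n-1,t^m-1)$. For subsets of $G$ the second variable is written $y$, and masks are regarded in $\mathbb{Z}[x,y]/(x^n-1,y^L-1)$, in which $y$ is invertible, so $y^{\eta r}$ makes sense for every integer $\eta$. In the definitions of $E_r,C_q$, the second coordinate $k\in\mathbb{Z}_{p^K}$ is written as $r+pj$ with $0\le r<p$ and $j\in\mathbb{Z}_L$. *)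

(* Defs.v *)
From HB Require Import structures.
From mathcomp Require Import all_boot all_order all_algebra all_field.
From mathcomp Require Import generic_quotient ring_quotient polyXY.
From mathcomp Require Import boolp.

Set Implicit Arguments.
Unset Strict Implicit.
Unset Printing Implicit Defensive.

Import Order.TTheory GRing.Theory Num.Theory.
Local Open Scope ring_scope.

(* Z/mZ for every m >= 1: the trivial group is included (unlike 'Z_1), and an
   element coerces to its representative in {0, ..., m-1}. *)
Notation Zmod m := 'I_(m.-1.+1).

Definition Zprod (n m : nat) : Type := (Zmod n * Zmod m)%type.

HB.instance Definition _ n m := Finite.on (Zprod n m).
HB.instance Definition _ n m := GRing.Zmodule.on (Zprod n m).

Definition tiling (H : finZmodType) (X Y : {set H}) : Prop :=
  forall w : H, exists! uv : H * H,
    [/\ uv.1 \in X, uv.2 \in Y & uv.1 + uv.2 = w].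

Definition slice (n p K : nat) (A : {set Zprod n (p ^ K)}) (r : nat) :
    {set Zprod n (p ^ K.-1)} :=
  [set g : Zprod n (p ^ K.-1) | (g.1, inZp (r + p * g.2)%N) \in A].

(* The variable x is the outer variable 'X of {poly {poly int}}; the second
   variable (t or y) is the inner one, 'Y. *)
Definition maskpoly (n m : nat) (A : {set Zprod n m}) : {poly {poly int}} :=
  \sum_(g in A) 'X^(g.1) * 'Y ^+ g.2.

(* f(x, 1), as a polynomial in x. *)
Definition at_y1 (f : {poly {poly int}}) : {poly int} :=
  map_poly (horner_eval 1) f.

Definition cyc1 (n : nat) : {pred {poly int}} :=
  [pred f | `[< exists a : {poly int}, f = a * ('X^n - 1) >]].

Definition cyc2 (n L : nat) : {pred {poly {poly int}}} :=
  [pred f | `[< exists a b : {poly {poly int}},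
                  f = a * ('X^n - 1) + b * ('Y ^+ L - 1) >]].

Fact cyc1_idealr n : idealr_closed (cyc1 n).
Proof.
split; rewrite ?inE.
- by apply/asboolP; exists 0; rewrite mul0r.
- apply/asboolP => -[a /(congr1 (horner_eval 1))].
  rewrite /horner_eval !hornerE expr1n subrr mulr0 => /eqP.
  by rewrite oner_eq0.
- move=> c u v; rewrite !inE => /asboolP[a ->] /asboolP[b ->].
  by apply/asboolP; exists (c * a + b); rewrite mulrDl mulrA.
Qed.

HB.instance Definition _ n := isIdealr.Build {poly int} (cyc1 n)
  (cyc1_idealr n).

Fact cyc2_idealr n L : idealr_closed (cyc2 n L).
Proof.
split; rewrite ?inE.
- by apply/asboolP; exists 0, 0; rewrite !mul0r addr0.
- apply/asboolP => -[a [b /(congr1 (fun f => f.[1, 1]))]].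
  rewrite !hornerE !expr1n !subrr !mulr0 addr0 => /eqP.
  by rewrite oner_eq0.
- move=> c u v; rewrite !inE => /asboolP[a [b ->]] /asboolP[a' [b' ->]].
  apply/asboolP; exists (c * a + a'), (c * b + b').
  by rewrite !mulrDl mulrDr !mulrA addrACA.
Qed.

HB.instance Definition _ n L := isIdealr.Build {poly {poly int}} (cyc2 n L)
  (cyc2_idealr n L).

Definition Zxy (n L : nat) : Type := {ideal_quot cyc2 n L}.

HB.instance Definition _ n L := GRing.ComNzRing.on (Zxy n L).

Definition to_Zxy (n L : nat) (f : {poly {poly int}}) : Zxy n L :=
  (\pi_{ideal_quot cyc2 n L} f)%qT.

(* Units of Zxy are the invertible elements and _^-1 is the inverse, so that
   u ^ z with z : int is the library's integer power. *)
Section ZxyUnits.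
Variables n L : nat.
Implicit Types u v : Zxy n L.

Definition Zxy_unit : pred (Zxy n L) :=
  fun u => `[< exists v, v * u = 1 >].

Definition Zxy_inv u : Zxy n L :=
  if pselect (exists v, v * u = 1) is left ex_v then projT1 (cid ex_v) else u.

Fact Zxy_mulVr : {in Zxy_unit, left_inverse 1 Zxy_inv *%R}.
Proof.
move=> u /asboolP ex_v; rewrite /Zxy_inv.
by case: pselect => // ex_v'; case: cid.
Qed.

Fact Zxy_unitP u v : v * u = 1 -> Zxy_unit u.
Proof. by move=> vu; apply/asboolP; exists v. Qed.

Fact Zxy_inv_out : {in [predC Zxy_unit], Zxy_inv =1 id}.
Proof. by move=> u /asboolPn nex; rewrite /Zxy_inv; case: pselect. Qed.

HB.instance Definition _ := GRing.ComNzRing_hasMulInverse.Build (Zxy n L)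
  Zxy_mulVr Zxy_unitP Zxy_inv_out.
End ZxyUnits.

Definition Zxy_y (n L : nat) : Zxy n L := to_Zxy n L 'Y.

Fact Zxy_yX n L : Zxy_y n L ^+ L = 1.
Proof.
rewrite /Zxy_y /to_Zxy -[1]/(1 : {ideal_quot cyc2 n L}).
have piX k : ((\pi_{ideal_quot cyc2 n L} 'Y) ^+ k
              = \pi_{ideal_quot cyc2 n L} ('Y ^+ k))%qT.
  elim: k => [|k IHk]; first by rewrite !expr0 rmorph1.
  by rewrite !exprS IHk rmorphM.
rewrite [LHS]piX -[RHS](rmorph1 (\pi_{ideal_quot cyc2 n L})%qT).
apply/eqP; rewrite -Quotient.idealrBE inE; apply/asboolP.
by exists 0, 1; rewrite mul0r add0r mul1r.
Qed.

Fact Zxy_y_unit n L : (0 < L)%N -> Zxy_y n L \is a GRing.unit.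
Proof.
move=> L_gt0; apply/unitrPr; exists (Zxy_y n L ^+ L.-1).
by rewrite -exprS prednK ?Zxy_yX.
Qed.

Definition Fmask (n p K : nat) (P : {set Zprod n (p ^ K)}) (eta : int) :
    Zxy n (p ^ K.-1) :=
  \sum_(r < p) Zxy_y n (p ^ K.-1) ^ (eta * r%:Z)
               * to_Zxy n (p ^ K.-1) (maskpoly (slice P r)).

(* A + (0, z), where z stands for its class modulo m. *)
Definition shift_y (n m : nat) (A : {set Zprod n m}) (z : int) :
    {set Zprod n m} :=
  [set g + ((0, inZp 1 *~ z) : Zprod n m) | g : Zprod n m in A].

(* Main.v *)
(* For a character (x, w) of Z_n x Z_L with w <> 1, the p-th roots of w are Galois
   conjugate over Q(x) because n and p are coprime; hence P or Q vanishes at all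
   of them, and so do all slices of that set at (x, w). At w = 1 the transform of
   D_eta * C_q is P(x,1) C_q(x,1), and only the following p-adic bound is needed.
   If Phi_p(t) divides Q(x,t), then C_q(x,1) = Q(x,1) / p and the product is nL
   for x = 1 and 0 otherwise; in particular this settles x = 1. If instead
   Phi_p(t) divides P(x,t), with x <> 1, then every Phi_(p^i)(t), 1 <= i <= K,
   divides P(x,t) or Q(x,t), and each of them gives a factor p of P(x,1) or of
   C_q(x,1), so that the product is divisible by p^K = pL. Fourier inversion shows
   that all the coefficients of D_eta * C_q are 1 modulo p, hence positive; as
   they add up to |P| |C_q| = nL, they are all equal to 1. The shifts eta r play
   no role beyond being trivial in the first coordinate. *)
Require Import Defs.
From mathcomp Require Import all_boot all_order all_algebra all_field.
From mathcomp Require Import generic_quotient ring_quotient polyXY.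
From mathcomp Require Import ring.

Import Order.TTheory GRing.Theory Num.Theory.
Local Open Scope ring_scope.
Local Open Scope quotient_scope.

(** * Power sums over roots of unity, and exact division by a monic polynomial over a subring *)

Lemma sum_prim_root {F : fieldType} {N : nat} {z : F} (m : nat) :
  N.-primitive_root z -> \sum_(k < N) z ^+ (k * m) = (N * (N %| m))%:R.
Proof.
move=> zN; have [Nm|Nm] /= := boolP (N %| m)%N.
  rewrite muln1 (eq_bigr (fun=> 1)) ?sumr_const ?card_ord // => k _.
  by rewrite mulnC exprM (eqP (_ : z ^+ m == 1)) ?expr1n // -(prim_order_dvd zN).
rewrite muln0; apply/eqP; have zm1 : z ^+ m - 1 != 0.
  by rewrite subr_eq0 -(prim_order_dvd zN).
rewrite -(inj_eq (mulfI zm1)) mulr0 (eq_bigr (fun k : 'I_N => (z ^+ m) ^+ k)).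
  by rewrite -subrX1 exprAC (prim_expr_order zN) expr1n subrr.
by move=> k _; rewrite mulnC exprM.
Qed.

(** As [D] is monic, [U] and [D * U] have the same leading coefficient, which therefore lies in [S];
    removing the leading term of [U] lowers its size, and induction applies. *)
Lemma polyOver_monic_quotient {R : nzRingType} (S : subringClosed R)
    (D U : {poly R}) :
  D \is monic -> D \is a polyOver S -> D * U \is a polyOver S ->
  U \is a polyOver S.
Proof.
move=> Dmon SD; have [m] := ubnP (size U); elim: m U => // m IHm U ltUm SDU.
have [->|U0] := eqVneq U 0; first by rewrite rpred0.
pose c := lead_coef U; pose k := (size U).-1.
have Sc : c \in S.
  by rewrite /c -(lead_coef_monicM U Dmon) lead_coefE (polyOverP SDU).
have ScX : c%:P * 'X^k \is a polyOver S by rewrite rpredM ?polyOverC ?rpredX ?polyOverX.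
have SDV : D * (U - c%:P * 'X^k) \is a polyOver S.
  by rewrite mulrBr rpredB // rpredM.
rewrite -[U](subrK (c%:P * 'X^k)) rpredD // IHm //.
apply: leq_trans (_ : size U <= m)%N; last by rewrite -ltnS.
rewrite -[ltnRHS]prednK ?size_poly_gt0 // ltnS; apply/leq_sizeP => j lekj.
rewrite coefB coefCM coefXn; have [->|nejk] := eqVneq j k.
  by rewrite mulr1 subrr.
rewrite mulr0 subr0 nth_default // -(prednK (_ : 0 < size U)%N) ?size_poly_gt0 //.
by rewrite ltn_neqAle eq_sym nejk.
Qed.

(* [Phi p i] is the cyclotomic polynomial of order p^(i+1). *)
Definition Phi (p i : nat) : {poly algC} := \sum_(j < p) 'X^(p ^ i * j).

(** * Cyclotomic polynomials of prime power order *)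

Section Phi.
Variables (p : nat) (p_prime : prime p).
Let p_gt0 := prime_gt0 p_prime.

Lemma Phi_mul i : ('X^(p ^ i) - 1) * Phi p i = 'X^(p ^ i.+1) - 1.
Proof.
rewrite expnSr exprM [RHS]subrX1; congr (_ * _).
by apply: eq_bigr => j _; rewrite exprM.
Qed.

Lemma Phi_monic i : Phi p i \is monic.
Proof.
have mX j : ('X^(p ^ j) - 1 : {poly algC}) \is monic.
  by rewrite -polyC1 monicXnsubC // expn_gt0 p_gt0.
by rewrite -(monicMl _ (mX i)) Phi_mul.
Qed.

Lemma Phi_Aint i : Phi p i \is a polyOver Aint.
Proof. by rewrite rpred_sum // => j _; rewrite rpredX ?polyOverX. Qed.

Lemma horner_Phi i z : z ^+ (p ^ i) = 1 -> (Phi p i).[z] = p%:R.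
Proof.
move=> z1; rewrite horner_sum (eq_bigr (fun=> 1)) ?sumr_const ?card_ord // => j _.
by rewrite hornerXn exprM z1 expr1n.
Qed.

(** After multiplication by ['X^(p ^ i) - 1] the divisor becomes a product of distinct linear
    factors, one for each root of unity of order dividing [p ^ i.+1]: the primitive ones are roots
    of [f], the others of the multiplier. *)
Lemma Phi_dvd i f :
  (forall z, (p ^ i.+1).-primitive_root z -> root f z) -> Phi p i %| f.
Proof.
move=> f0; have pi_gt0 j : (0 < p ^ j)%N by rewrite expn_gt0 p_gt0.
have X0 : ('X^(p ^ i) - 1 : {poly algC}) != 0.
  by rewrite -polyC1 monic_neq0 // monicXnsubC.
rewrite -(dvdp_mul2l _ _ X0) Phi_mul.
have [z zN] := C_prim_root_exists (pi_gt0 i.+1).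
rewrite -(factor_Xn_sub_1 zN) -(big_map (fun k => z ^+ k) predT (fun w => 'X - w%:P)).
apply: uniq_roots_dvdp; last first.
  rewrite uniq_rootsE map_inj_in_uniq ?iota_uniq // => a b.
  rewrite !mem_index_iota /= => lta ltb /eqP.
  by rewrite (eq_prim_root_expr zN) !modn_small // => /eqP.
apply/allP => w /mapP[k _ ->]; rewrite rootM.
have [/(f0 _)->|nprim] := boolP ((p ^ i.+1).-primitive_root (z ^+ k)).
  by rewrite orbT.
rewrite (prim_root_exp_coprime _ zN) coprime_sym coprime_pexpl // in nprim.
rewrite prime_coprime // negbK in nprim.
apply/orP; left; rewrite /root !hornerE subr_eq0 -exprM -(prim_order_dvd zN).
by rewrite expnS dvdn_mul.
Qed.

(** A common divisor divides ['X^(p ^ j) - 1], because [Phi p i] does. Modulo that polynomial each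
    of the [p] terms of [Phi p j] is 1, so the divisor also divides the nonzero constant [p]. *)
Lemma coprimep_Phi i j : (i < j)%N -> coprimep (Phi p i) (Phi p j).
Proof.
move=> ltij; apply/coprimepP => d di dj.
have dX : d %| 'X^(p ^ j) - 1.
  apply: dvdp_trans di (dvdp_trans (dvdp_mull ('X^(p ^ i) - 1) (dvdpp _)) _).
  rewrite Phi_mul -(subnK ltij) addnC expnD exprM [X in _ %| X]subrX1; exact: dvdp_mulr.
have: d %| (p%:R)%:P; last first.
  rewrite -size_poly_eq1 => /dvdp_leq; rewrite polyC_eq0 pnatr_eq0 -lt0n p_gt0.
  rewrite size_polyC pnatr_eq0 -lt0n p_gt0 => /(_ isT) le1.
  rewrite eqn_leq le1 size_poly_gt0; apply: contraTneq di => ->.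
  by rewrite dvd0p monic_neq0 ?Phi_monic.
rewrite (_ : _%:P = Phi p j - \sum_(k < p) (('X^(p ^ j)) ^+ k - 1)).
  rewrite dvdp_sub //; elim/big_ind: _ => [|u v|k _]; first exact: dvdp0.
    exact: dvdp_add.
  by rewrite subrX1; apply: dvdp_trans dX (dvdp_mulr _ (dvdpp _)).
rewrite /Phi -sumrB (eq_bigr (fun=> 1)) ?sumr_const ?card_ord ?polyCMn // => k _.
by rewrite exprM opprB addrC subrK.
Qed.

Lemma prod_Phi_dvd f (r : seq nat) :
  sorted ltn r -> (forall i, i \in r -> Phi p i %| f) ->
  \prod_(i <- r) Phi p i %| f.
Proof.
elim: r => [|i r IHr] /=; first by rewrite big_nil dvd1p.
move=> /[dup] ltr /path_sorted sr fr; rewrite big_cons Gauss_dvdp.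
  by rewrite fr ?mem_head ?IHr // => j jr; rewrite fr // in_cons jr orbT.
have {}ltr : {in r, forall j, i < j}%N.
  by apply/allP; apply: order_path_min ltr => //; apply: ltn_trans.
rewrite big_seq; elim/big_rec: _ => [|j g jr cop]; first exact: coprimep1.
by rewrite coprimepMr cop coprimep_Phi ?ltr.
Qed.

(* The sum is [p] times the coefficient of [X^q] in [g] modulo [X^p - 1]. Each
   [Phi p i] contributes a factor [p]: to [f 1], and, since it is congruent to
   [p] modulo [X^p - 1] for [0 < i], to that coefficient. *)
Lemma Aint_slice_product f g zeta (r s : seq nat) (q : nat) :
  p.-primitive_root zeta -> f \is a polyOver Aint -> g \is a polyOver Aint ->
  sorted ltn r -> (forall i, i \in r -> Phi p i %| f) ->
  sorted ltn s -> (forall i, i \in s -> (0 < i)%N && (Phi p i %| g)) ->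
  exists2 a, a \in Aint &
    f.[1] * \sum_(k < p) zeta ^+ (k * (p - q)) * g.[zeta ^+ k]
      = p%:R ^+ (size r + size s).+1 * a.
Proof.
move=> zp fA gA r_sorted rf s_sorted sg.
have prod_mon t : \prod_(i <- t) Phi p i \is monic.
  by apply: monic_prod => i _; apply: Phi_monic.
have prod_A t : \prod_(i <- t) Phi p i \is a polyOver Aint.
  by rewrite rpred_prod // => i _; apply: Phi_Aint.
have quot h t : h \is a polyOver Aint -> sorted ltn t ->
    (forall i, i \in t -> Phi p i %| h) ->
    exists2 U, U \is a polyOver Aint & h = \prod_(i <- t) Phi p i * U.
  move=> hA st th; have /dvdpP[U Uh] := prod_Phi_dvd _ _ st th.
  exists U; last by rewrite mulrC.
  by apply: polyOver_monic_quotient _ _ _ (prod_mon t) (prod_A t) _; rewrite mulrC -Uh.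
have [U UA Uf] := quot f r fA r_sorted rf.
have [V VA Vg] := quot g s gA s_sorted (fun i si => proj2 (andP (sg i si))).
have hprod t z : (forall i, i \in t -> z ^+ (p ^ i) = 1) ->
    (\prod_(i <- t) Phi p i).[z] = p%:R ^+ size t.
  move=> zt; rewrite horner_prod big_seq (eq_bigr (fun=> p%:R)) => [|i ti].
    by rewrite -big_seq big_const_seq count_predT iter_mulr_1.
  exact: horner_Phi (zt _ ti).
(* For [q <= p], the exponent [p - q] stands for [-q] within the naturals: summation over the [p]-th
   roots of unity keeps exactly the coefficients of [V] whose index is [q] modulo [p]. *)
exists (U.[1] * \sum_(m < size V) V`_m * (p %| p - q + m)%:R).
  rewrite rpredM ?rpred_horner ?rpred1 // rpred_sum // => m _.
  by rewrite rpredM ?rpred_nat ?(polyOverP VA).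
rewrite Uf hornerM hprod => [|i _]; last by rewrite expr1n.
rewrite exprSr exprD.
set G := \sum_(k < p) _; set W := \sum_(m < size V) _.
suff -> : G = p%:R ^+ size s * p%:R * W.
  by ring.
rewrite {}/G.
transitivity (\sum_(k < p) p%:R ^+ size s *
               \sum_(m < size V) V`_m * zeta ^+ (k * (p - q + m))).
  apply: eq_bigr => k _; rewrite Vg hornerM hprod => [|i si].
    rewrite mulrCA horner_coef mulr_sumr; congr (_ * _); apply: eq_bigr => m _.
    by rewrite mulrCA -exprM -exprD mulnDr.
  have /andP[i_gt0 _] := sg i si; rewrite -(prednK i_gt0) expnS.
  by rewrite -exprM mulnCA exprM (prim_expr_order zp) expr1n.
rewrite -mulr_sumr exchange_big /= -mulrA; congr (_ * _); rewrite /W mulr_sumr; apply: eq_bigr => m _.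
by rewrite -mulr_sumr (sum_prim_root _ zp) natrM mulrCA.
Qed.
End Phi.

(** * Characters and values of masks *)

Definition chi {R : comNzRingType} {n m : nat} (x t : R) (g : Zprod n m) : R :=
  x ^+ g.1 * t ^+ g.2.

(** The value of the mask at [(x, t)]. The ring is arbitrary because [ev] serves at complex
    characters, over polynomial rings and in [Zxy]. *)
Definition ev {R : comNzRingType} {n m : nat} (x t : R) (A : {set Zprod n m}) : R :=
  \sum_(g in A) chi x t g.

Lemma rmorph_ev {R S : comNzRingType} (u : {rmorphism R -> S}) {n m : nat}
  (x t : R) (A : {set Zprod n m}) : u (ev x t A) = ev (u x) (u t) A.
Proof. by rewrite rmorph_sum; apply: eq_bigr => g _; rewrite rmorphM !rmorphXn. Qed.

Lemma ev11 {R : comNzRingType} {n m : nat} (A : {set Zprod n m}) :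
  ev 1 1 A = #|A|%:R :> R.
Proof. by rewrite -sumr_const; apply: eq_bigr => g _; rewrite /chi !expr1n mulr1. Qed.

Lemma expr_ZmodD {R : comNzRingType} {n : nat} {x : R} (a b : Zmod n) :
  (0 < n)%N -> x ^+ n = 1 -> x ^+ (a + b)%R = x ^+ a * x ^+ b.
Proof.
move=> n0; rewrite -{1}(prednK n0) => xn.
by rewrite -exprD -[RHS](expr_mod _ xn).
Qed.

Lemma chiD {R : comNzRingType} {n m : nat} {x t : R} (g h : Zprod n m) :
  (0 < n)%N -> (0 < m)%N -> x ^+ n = 1 -> t ^+ m = 1 ->
  chi x t (g + h) = chi x t g * chi x t h.
Proof. by move=> n0 m0 xn tm; rewrite /chi !expr_ZmodD // mulrACA. Qed.

Lemma ev_setT {R : comNzRingType} {n m : nat} (x t : R) :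
  ev x t [set: Zprod n m]
    = (\sum_(i < n.-1.+1) x ^+ i) * (\sum_(j < m.-1.+1) t ^+ j).
Proof.
rewrite /ev big_distrlr /= pair_bigA; apply: eq_big => // g.
by rewrite in_setT.
Qed.

Lemma sum_expr_eq0 {R : idomainType} {N : nat} {x : R} :
  (0 < N)%N -> x ^+ N = 1 -> x != 1 -> \sum_(i < N.-1.+1) x ^+ i = 0.
Proof.
move=> N0 xN x1; rewrite prednK //; apply/eqP.
have := subrX1 x N; rewrite xN subrr => /esym/eqP.
by rewrite mulf_eq0 subr_eq0 (negPf x1).
Qed.

Lemma ev_setT_eq0 {R : idomainType} {n m : nat} {x t : R} :
  (0 < n)%N -> (0 < m)%N -> x ^+ n = 1 -> t ^+ m = 1 -> (x, t) != (1, 1) ->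
  ev x t [set: Zprod n m] = 0.
Proof.
move=> n0 m0 xn tm; rewrite ev_setT xpair_eqE negb_and => /orP[x1|t1].
  by rewrite sum_expr_eq0 ?mul0r.
by rewrite (sum_expr_eq0 m0) ?mulr0.
Qed.

Lemma ltn_Zmod {m : nat} (a : Zmod m) : (0 < m)%N -> (a < m)%N.
Proof. by move=> m0; rewrite -[ltnRHS]prednK. Qed.

(** * Slices modulo [p], and the transform of a tiling *)

Lemma slice_lt {p K : nat} (r : 'I_p) (j : Zmod (p ^ K.-1)) : (0 < K)%N ->
  (r + p * j < p ^ K)%N.
Proof.
move=> K0; have p0 : (0 < p)%N by case: p r {j} => [[]|].
apply: (@leq_trans (p * j.+1)); first by rewrite mulnS ltn_add2r.
by rewrite -[in leqRHS](prednK K0) expnS leq_mul2l ltn_Zmod ?orbT // expn_gt0 p0.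
Qed.

(** Euclidean division of the second coordinate by [p] is a bijection: [h] recombines remainder and
    quotient, [k] separates them. *)
Lemma sum_slice {R : nmodType} {n p K : nat} (A : {set Zprod n (p ^ K)})
    (F : Zmod n -> nat -> R) :
  (0 < p)%N -> (0 < K)%N ->
  \sum_(g in A) F g.1 g.2
    = \sum_(r < p) \sum_(g in slice A r) F g.1 (r + p * g.2)%N.
Proof.
move=> p0 K0; have pK0 : (0 < p ^ K)%N by rewrite expn_gt0 p0.
rewrite pair_big_dep /=.
pose h (u : 'I_p * Zprod n (p ^ K.-1)) : Zprod n (p ^ K) :=
  (u.2.1, inZp (u.1 + p * u.2.2)).
have vh u : (h u).2 = (u.1 + p * u.2.2)%N :> nat.
  by rewrite /= modn_small // [ltnRHS]prednK // slice_lt.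
rewrite (reindex h) /=.
  apply: eq_big => [u|u _]; rewrite ?inE //.
  by have /= -> := vh u.
have p'0 : (0 < p ^ K.-1)%N by rewrite expn_gt0 p0.
pose k (g : Zprod n (p ^ K)) : 'I_p * Zprod n (p ^ K.-1) :=
  (Ordinal (ltn_pmod g.2 p0), (g.1, inZp (g.2 %/ p)%N)).
exists k => [[r [a b]] _|[a b] _]; last first.
  congr (_, _); apply: val_inj.
  rewrite [LHS]vh /= [in X in (_ + X)%N]modn_small.
    by rewrite addnC mulnC -divn_eq.
  by rewrite [ltnRHS]prednK // ltn_divLR // -expnSr [K.-1.+1]prednK // ltn_Zmod.
have /= E := vh (r, (a, b)).
congr (_, (_, _)); apply: val_inj; rewrite /= E.
  by rewrite addnC mulnC modnMDl modn_small.
by rewrite addnC mulnC divnMDl // divn_small // addn0 modn_small.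
Qed.

Lemma ev_slice {R : comNzRingType} {n p K : nat} (A : {set Zprod n (p ^ K)}) (x t : R) :
  (0 < p)%N -> (0 < K)%N ->
  ev x t A = \sum_(r < p) t ^+ r * ev x (t ^+ p) (slice A r).
Proof.
move=> p0 K0; rewrite /ev /chi (sum_slice _ (fun a b => x ^+ a * t ^+ b)) //.
apply: eq_bigr => r _; rewrite mulr_sumr; apply: eq_bigr => g _.
by rewrite exprD exprM mulrCA.
Qed.

(** Grouping the pairs of the product by their sum leaves a single pair in every fibre. *)
Lemma ev_tiling {R : comNzRingType} {n m : nat} {x t : R} (X Y : {set Zprod n m}) :
  (0 < n)%N -> (0 < m)%N -> x ^+ n = 1 -> t ^+ m = 1 ->
  tiling X Y -> ev x t X * ev x t Y = ev x t [set: Zprod n m].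
Proof.
move=> n0 m0 xn tm XY; rewrite /ev big_distrlr /= pair_big_dep /=.
rewrite (partition_big (fun u : Zprod n m * Zprod n m => u.1 + u.2) (mem setT)) => [|//].
apply: eq_bigr => w _; have [[u v] [[/= uX vY uvw] uniq]] := XY w.
rewrite (big_pred1 (u, v)) => [|[u' v']] /=; first by rewrite -chiD // uvw.
apply/andP/eqP => [[/andP[u'X v'Y] /eqP u'v'w]|[-> ->]].
  by symmetry; apply: uniq.
by rewrite uX vY uvw /=.
by move=> u _; rewrite /= in_setT.
Qed.

(** * Galois conjugation, and recovery of a slice from the whole set *)

(** The Chinese remainder theorem gives an exponent [k'] that is 1 modulo [n] and carries [z] to
    [z']. It is coprime to [n * p ^ i], so raising to that power extends to a field morphism, which
    fixes [x]. *)
Lemma ev_conj {n m p i : nat} (A : {set Zprod n m}) (x z z' : algC) :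
  (0 < n)%N -> coprime n p -> x ^+ n = 1 ->
  (p ^ i).-primitive_root z -> (p ^ i).-primitive_root z' ->
  ev x z A = 0 -> ev x z' A = 0.
Proof.
move=> n0 np xn zp z'p A0.
have npi : coprime n (p ^ i) by rewrite coprimeXr.
have [k z'k] := prim_rootP zp (prim_expr_order z'p).
have kp : coprime k (p ^ i) by rewrite -(prim_root_exp_coprime _ zp) -z'k.
pose k' := chinese n (p ^ i) 1 k.
have k'n : (k' %% n = 1 %% n)%N := chinese_modl npi 1 k.
have k'p : (k' %% (p ^ i) = k %% (p ^ i))%N := chinese_modr npi 1 k.
have k'co : coprime k' (n * p ^ i).
  rewrite coprimeMr -[X in X && _]coprime_modl k'n coprime_modl coprime1n /=.
  by rewrite -coprime_modl k'p coprime_modl.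
have [u uE] := Qn_aut_exists k'co.
have <- : u x = x.
  rewrite uE; last by rewrite exprM xn expr1n.
  by rewrite -(expr_mod _ xn) k'n (expr_mod _ xn) expr1.
have -> : z' = u z.
  rewrite uE; last by rewrite mulnC exprM (prim_expr_order zp) expr1n.
  by rewrite -(prim_expr_mod zp) k'p (prim_expr_mod zp).
by rewrite -rmorph_ev A0 rmorph0.
Qed.

(** The order of [z] is some [p ^ j] with [j <= i.+1]; if [j <= i], the order of [z ^+ p] would
    divide [p ^ i.-1]. For [i = 0] this would fail at [z = 1]. *)
Lemma prim_root_expp {F : fieldType} {p i : nat} (z : F) :
  prime p -> (0 < i)%N -> (p ^ i).-primitive_root (z ^+ p) ->
  (p ^ i.+1).-primitive_root z.
Proof.
move=> pp i0 zp; have z1 : z ^+ (p ^ i.+1) = 1.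
  by rewrite expnS exprM (prim_expr_order zp).
have [|d dprim /dvdn_pfactor] := prim_order_exists _ z1.
  by rewrite expn_gt0 prime_gt0.
move=> /(_ pp)[j leji def_d]; rewrite {d}def_d in dprim.
have [ltij|lej] := ltnP i j; first by rewrite (_ : i.+1 = j) //; apply/eqP; rewrite eqn_leq ltij.
have : (z ^+ p) ^+ (p ^ i.-1) = 1.
  rewrite -exprM -expnS prednK //; apply/eqP; rewrite -(prim_order_dvd dprim).
  exact: dvdn_exp2l.
move/eqP; rewrite -(prim_order_dvd zp) dvdn_Pexp2l ?prime_gt1 //.
by rewrite -ltnS prednK // ltnn.
Qed.

(** The points [t * zeta ^+ k] share their [p]-th power, so all of them see the same slice values; a
    discrete Fourier transform in [k] isolates the residue [q]. *)
Lemma slice_extract {F : fieldType} {n p K : nat} (A : {set Zprod n (p ^ K)})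
    (x t zeta : F) (q : 'I_p) :
  (0 < K)%N -> p.-primitive_root zeta ->
  \sum_(k < p) zeta ^+ (k * (p - q)) * ev x (t * zeta ^+ k) A
    = p%:R * (t ^+ q * ev x (t ^+ p) (slice A q)).
Proof.
move=> K0 zp; have p0 := prim_order_gt0 zp.
transitivity (\sum_(k < p) \sum_(r < p)
    t ^+ r * ev x (t ^+ p) (slice A r) * zeta ^+ (k * (p - q + r))).
  apply: eq_bigr => k _; rewrite ev_slice // mulr_sumr; apply: eq_bigr => r _.
  rewrite [in ev _ _ _]exprMn [(zeta ^+ k) ^+ p]exprAC (prim_expr_order zp).
  rewrite expr1n mulr1 exprMn -exprM mulnDr exprD; ring.
rewrite exchange_big /= (eq_bigr (fun r : 'I_p =>
    (r == q)%:R * (p%:R * (t ^+ r * ev x (t ^+ p) (slice A r))))) => [|r _].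
  by rewrite (bigD1 q) //= eqxx mul1r big1 ?addr0 // => r /negPf->; rewrite mul0r.
rewrite -mulr_sumr sum_prim_root // (_ : (p %| _)%N = (r == q)).
  by rewrite natrM; ring.
apply/idP/eqP => [pqr|->]; last by rewrite subnK // ltnW.
apply/eqP; rewrite -val_eqE /=.
have : ((r + p) %% p == q %% p)%N.
  by rewrite -[X in (r + X)%N](subnK (ltnW (ltn_ord q))) addnA eqn_mod_dvd ?leq_addl // addnK addnC.
by rewrite modnDr !modn_small.
Qed.

(** * Vanishing and divisibility of the transforms at each character *)

Section Spectrum.
Variables (p n K : nat) (P Q : {set Zprod n (p ^ K)}) (zeta : algC).
Hypotheses (p_prime : prime p) (n_gt0 : (0 < n)%N) (K_gt0 : (0 < K)%N).
Hypotheses (np_coprime : coprime n p) (zeta_prim : p.-primitive_root zeta).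
Hypotheses (PQ : tiling P Q) (Q_zeta : ev 1 zeta Q = 0).

Let L := (p ^ K.-1)%N.
Let p_gt0 : (0 < p)%N := prime_gt0 p_prime.
Let pX_gt0 i : (0 < p ^ i)%N. Proof. by rewrite expn_gt0 p_gt0. Qed.
Let p_neq0 : p%:R != 0 :> algC. Proof. by rewrite pnatr_eq0 -lt0n. Qed.

Lemma ev_prod_eq0 (x t : algC) :
  x ^+ n = 1 -> t ^+ (p ^ K) = 1 -> (x, t) != (1, 1) -> ev x t P * ev x t Q = 0.
Proof. by move=> xn tK xt1; rewrite (ev_tiling _ _ _ _ _ _ PQ) ?ev_setT_eq0. Qed.

(** The tiling forces one factor to vanish at one primitive root, and [ev_conj] spreads this to all
    of them at the same [x]. *)
Lemma ev_vanish (x : algC) i : (i < K)%N -> x ^+ n = 1 ->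
  (forall z, (p ^ i.+1).-primitive_root z -> ev x z P = 0)
  \/ (forall z, (p ^ i.+1).-primitive_root z -> ev x z Q = 0).
Proof.
move=> ltiK xn; have [z zp] := C_prim_root_exists (pX_gt0 i.+1).
have : ev x z P * ev x z Q = 0.
  apply: ev_prod_eq0 => //.
    apply/eqP; rewrite -(prim_order_dvd zp); exact: dvdn_exp2l.
  rewrite xpair_eqE negb_and; apply/orP; right.
  rewrite -(expr1 z) -(prim_order_dvd zp) dvdn1 -(expn0 p) eqn_exp2l //.
  exact: prime_gt1.
move/eqP; rewrite mulf_eq0 => /orP[] /eqP e0; [left | right] => w wp.
  exact: (ev_conj _ _ _ _ n_gt0 np_coprime xn zp wp e0).
exact: (ev_conj _ _ _ _ n_gt0 np_coprime xn zp wp e0).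
Qed.

(** Since [0 < i], every [p]-th root of [w] is primitive of order [p ^ i.+1], so every term of
    [slice_extract] is zero. *)
Lemma slices_vanish (x w : algC) (A : {set Zprod n (p ^ K)}) i (q : 'I_p) :
  (0 < i)%N -> (p ^ i).-primitive_root w ->
  (forall z, (p ^ i.+1).-primitive_root z -> ev x z A = 0) ->
  ev x w (slice A q) = 0.
Proof.
move=> i_gt0 wp A0; pose t := p.-root w; have tp : t ^+ p = w by apply: rootCK.
have : p%:R * (t ^+ q * ev x w (slice A q)) = 0.
  rewrite -tp -(slice_extract _ _ _ _ _ K_gt0 zeta_prim) big1 // => k _.
  rewrite A0 ?mulr0 //; apply: prim_root_expp => //.
  by rewrite exprMn exprAC (prim_expr_order zeta_prim) expr1n mulr1 tp.
move/eqP; rewrite !mulf_eq0 (negPf p_neq0) /= => /orP[|/eqP//].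
(* The root [t] is nonzero, since its power [w] is a root of unity. *)
rewrite expf_eq0 => /andP[_ t0]; have := prim_expr_order wp.
rewrite -tp (eqP t0) -exprM expr0n muln_eq0 !eqn0Ngt p_gt0 pX_gt0 /= => /eqP.
by rewrite eq_sym oner_eq0.
Qed.

(** All slices of one set vanish at once, so any weighted sum of the slices of [P] still gives a
    zero product. *)
Lemma slices_product_eq0 (x w : algC) : x ^+ n = 1 -> w ^+ L = 1 -> w != 1 ->
  (forall r : 'I_p, ev x w (slice P r) = 0)
  \/ (forall q : 'I_p, ev x w (slice Q q) = 0).
Proof.
move=> xn wL w1; have [d dw /dvdn_pfactor] := prim_order_exists (pX_gt0 _) wL.
move=> /(_ p_prime)[i leiK def_d]; rewrite {d}def_d in dw.
have i_gt0 : (0 < i)%N.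
  rewrite lt0n; apply: contraNneq w1 => i0; rewrite i0 in dw.
  by rewrite -(expr1 w) (prim_expr_order dw).
have ltiK : (i < K)%N by rewrite -(prednK K_gt0) ltnS.
by have [P0|Q0] := ev_vanish x i ltiK xn; [left|right] => r;
  apply: slices_vanish i_gt0 dw _.
Qed.

Lemma ev_polyXE (A : {set Zprod n (p ^ K)}) (x z : algC) :
  (ev x%:P 'X A).[z] = ev x z A.
Proof.
rewrite horner_sum; apply: eq_bigr => g _.
by rewrite hornerM horner_exp hornerC hornerXn.
Qed.

Lemma slice_at1 (x : algC) (q : 'I_p) :
  x ^+ n = 1 ->
  if x == 1 then ev x 1 P * ev x 1 (slice Q q) = (n * L)%:R
  else exists2 a, a \in Aint & ev x 1 P * ev x 1 (slice Q q) = (p ^ K)%:R * a.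
Proof.
move=> xn.
have extract (A : {set Zprod n (p ^ K)}) : p%:R * ev x 1 (slice A q) =
    \sum_(k < p) zeta ^+ (k * (p - q)) * ev x (zeta ^+ k) A.
  have := slice_extract A x 1 zeta q K_gt0 zeta_prim.
  rewrite !expr1n mul1r => <-; apply: eq_bigr => k _.
  by rewrite mul1r.
(* If [Q] vanishes at the nontrivial [p]-th roots of unity, only the term [k = 0] of the extraction
   survives. *)
have ev_PQ1 : (forall z, (p ^ 1).-primitive_root z -> ev x z Q = 0) ->
    p%:R * (ev x 1 P * ev x 1 (slice Q q)) = ev x 1 P * ev x 1 Q.
  move=> Q0; rewrite mulrCA extract; congr (_ * _).
  rewrite (bigD1 (Ordinal p_gt0)) //= mul0n expr0 mul1r big1 ?addr0 // => k k0.
  rewrite Q0 ?mulr0 // expn1 prim_root_exp_coprime // coprime_sym prime_coprime //.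
  by rewrite gtnNdvd // lt0n; apply: contra k0 => /eqP k0; apply/eqP/val_inj.
have [x1|x1] := eqVneq x 1.
  apply: (mulfI p_neq0); rewrite ev_PQ1 => [|z zp].
    rewrite x1 (ev_tiling _ _ _ _ _ _ PQ) ?expr1n //.
    rewrite ev11 cardsT card_prod !card_ord !prednK // -natrM.
    by rewrite /L mulnCA -expnS prednK.
  by rewrite x1; apply: (@ev_conj _ _ p 1 _ _ zeta); rewrite ?expn1 ?expr1n.
have [P0|/ev_PQ1 E] := ev_vanish x 0 K_gt0 xn; last first.
  exists 0; rewrite ?rpred0 // mulr0; apply: (mulfI p_neq0).
  by rewrite E ev_prod_eq0 ?mulr0 ?expr1n // xpair_eqE (negPf x1).
(* The [K] indices are split so that each is used once: those in [r] give factors of [P], the rest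
   factors of [Q]. As [P] takes the index 0, all indices in [s] are positive. *)
pose r := [seq i <- iota 0 K | Phi p i %| ev x%:P 'X P].
pose s := [seq i <- iota 0 K | ~~ (Phi p i %| ev x%:P 'X P)].
have dvd0 : Phi p 0 %| ev x%:P 'X P.
  by apply: Phi_dvd => // z zp; rewrite /root ev_polyXE P0.
have xA : x \in Aint by apply: (Aint_unity_root n_gt0); apply/unity_rootP.
have evA (A : {set Zprod n (p ^ K)}) : ev x%:P 'X A \is a polyOver Aint.
  by apply: rpred_sum => g _; rewrite rpredM ?rpredX ?polyOverX ?polyOverC.
have iota_sorted a : sorted ltn [seq i <- iota 0 K | a i].
  by rewrite sorted_filter ?iota_ltn_sorted //; apply: ltn_trans.
have [|i|a aA E] := Aint_slice_product _ p_prime _ _ _ r s q zeta_prim (evA P) (evA Q)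
  (iota_sorted _) _ (iota_sorted _).
- by move=> i; rewrite mem_filter => /andP[].
- rewrite mem_filter mem_iota add0n => /and3P[nPi _ ltiK]; apply/andP; split.
    by rewrite lt0n; apply: contraNneq nPi => ->.
  apply: Phi_dvd => // z zp; rewrite /root ev_polyXE.
  have [Pi0|->//] := ev_vanish x i ltiK xn; case/negP: nPi.
  by apply: Phi_dvd => // w wp; rewrite /root ev_polyXE Pi0.
(* The product carries [p ^ K.+1], one factor [p] of which belongs to the extraction and cancels. *)
exists a => //; apply: (mulfI p_neq0).
have rsK : (size r + size s = K)%N by rewrite !size_filter count_predC size_iota.
rewrite rsK in E; rewrite mulrCA extract mulrA natrX -exprS -E ev_polyXE; congr (_ * _).
by apply: eq_bigr => k _; rewrite ev_polyXE.
Qed.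

(** * Fourier inversion and the number of representations *)

Lemma fourier_inversion {m : nat} (e w : algC) (c : Zprod n m -> algC) g0 :
  (0 < m)%N -> n.-primitive_root e -> m.-primitive_root w ->
  \sum_(a < n) \sum_(b < m) chi (e ^+ a) (w ^+ b) (- g0)
      * \sum_(g : Zprod n m) c g * chi (e ^+ a) (w ^+ b) g
    = (n * m)%:R * c g0.
Proof.
move=> m_gt0 en wm.
have ea a : (e ^+ a) ^+ n = 1 by rewrite exprAC (prim_expr_order en) expr1n.
have wb b : (w ^+ b) ^+ m = 1 by rewrite exprAC (prim_expr_order wm) expr1n.
transitivity (\sum_(g : Zprod n m) c g *
    ((\sum_(a < n) e ^+ (a * (g - g0).1)) * (\sum_(b < m) w ^+ (b * (g - g0).2)))).
  under eq_bigr => a _ do under eq_bigr => b _ do rewrite mulr_sumr.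
  under eq_bigr => a _ do rewrite exchange_big.
  rewrite exchange_big; apply: eq_bigr => g _ /=; rewrite big_distrlr mulr_sumr /=.
  apply: eq_bigr => a _; rewrite mulr_sumr; apply: eq_bigr => b _.
  transitivity (c g * chi (e ^+ a) (w ^+ b) (g - g0)).
    by rewrite chiD //; ring.
  by rewrite /chi -!exprM.
have dvd_eq0 k (d : Zmod k) : (0 < k)%N -> (k %| d)%N = (d == 0).
  by move=> k_gt0; rewrite -val_eqE /= /dvdn modn_small //; apply: ltn_Zmod.
rewrite (eq_bigr (fun g => (g == g0)%:R * ((n * m)%:R * c g))) => [|g _].
  by rewrite (bigD1 g0) //= eqxx mul1r big1 ?addr0 // => g /negPf->; rewrite mul0r.
rewrite !sum_prim_root // !dvd_eq0 // -[g == g0]subr_eq0.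
rewrite (_ : (g - g0 == 0) = ((g - g0).1 == 0) && ((g - g0).2 == 0)) //.
by rewrite -mulnb !natrM; ring.
Qed.

Variable s : 'I_p -> Zprod n L.
Hypothesis s1 : forall r, (s r).1 = 0.
Variable q : 'I_p.

(** The slice index is part of the counted data, so overlapping translates count separately; the
    value 1 everywhere then gives both disjointness and tiling. *)
Definition nrepr (w : Zprod n L) : nat :=
  #|[set u : 'I_p * (Zprod n L * Zprod n L) |
     [&& u.2.1 \in slice P u.1, u.2.2 \in slice Q q & u.2.1 + s u.1 + u.2.2 == w]]|.

Lemma nrepr_hat (x t : algC) : x ^+ n = 1 -> t ^+ L = 1 ->
  \sum_(g : Zprod n L) (nrepr g)%:R * chi x t g
    = (\sum_(r < p) chi x t (s r) * ev x t (slice P r)) * ev x t (slice Q q).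
Proof.
move=> xn tL.
transitivity (\sum_(u : 'I_p * (Zprod n L * Zprod n L) |
    (u.2.1 \in slice P u.1) && (u.2.2 \in slice Q q))
    chi x t (u.2.1 + s u.1 + u.2.2)).
  rewrite (partition_big (fun u => u.2.1 + s u.1 + u.2.2) predT) //=.
  apply: eq_bigr => g _; rewrite mulrC mulr_natr -sumr_const.
  apply: eq_big => [u|u]; rewrite inE andbA //.
  by case/andP=> _ /eqP->.
rewrite mulr_suml; transitivity (\sum_(r < p)
    \sum_(v : Zprod n L * Zprod n L | (v.1 \in slice P r) && (v.2 \in slice Q q))
      chi x t (v.1 + s r + v.2)); first by rewrite pair_big_dep.
apply: eq_bigr => r _; rewrite /ev -mulrA big_distrlr pair_big_dep mulr_sumr.
apply: eq_bigr => v _ /=; rewrite !chiD ?pX_gt0 //; ring.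
Qed.

(** At [t = 1] a shift with zero first coordinate is invisible, and the slices recombine into
    [P]. *)
Lemma nrepr_hat1 (x : algC) : x ^+ n = 1 ->
  \sum_(g : Zprod n L) (nrepr g)%:R * chi x 1 g = ev x 1 P * ev x 1 (slice Q q).
Proof.
move=> xn; rewrite nrepr_hat ?expr1n // [ev x 1 P]ev_slice //; congr (_ * _).
by apply: eq_bigr => r _; rewrite /chi s1 !expr1n !mul1r.
Qed.

Lemma nrepr_gt0 w : (0 < nrepr w)%N.
Proof.
have [e en] := C_prim_root_exists n_gt0.
have [z zL] := C_prim_root_exists (pX_gt0 K.-1 : (0 < L)%N).
have eX a : (e ^+ a) ^+ n = 1 by rewrite exprAC (prim_expr_order en) expr1n.
have := fourier_inversion e z (fun g => (nrepr g)%:R) w (pX_gt0 _) en zL.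
set i0 := Ordinal n_gt0; set j0 := Ordinal (pX_gt0 K.-1 : (0 < L)%N).
(* Characters nontrivial in the second variable contribute nothing, so only [b = 0] remains. *)
have term0 (a : 'I_n) : \sum_(b < L) chi (e ^+ a) (z ^+ b) (- w) *
    (\sum_(g : Zprod n L) (nrepr g)%:R * chi (e ^+ a) (z ^+ b) g)
    = chi (e ^+ a) 1 (- w) * (ev (e ^+ a) 1 P * ev (e ^+ a) 1 (slice Q q)).
  rewrite (bigD1 j0) //= expr0 nrepr_hat1 // big1 ?addr0 // => b b0.
  have zb : (z ^+ b) ^+ L = 1 by rewrite exprAC (prim_expr_order zL) expr1n.
  have zb1 : z ^+ b != 1.
    rewrite -(prim_order_dvd zL) gtnNdvd // lt0n.
    by apply: contra b0 => /eqP b0; apply/eqP/val_inj.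
  rewrite nrepr_hat //.
  have [P0|->] := slices_product_eq0 _ _ (eX a) zb zb1; last by rewrite !mulr0.
  by rewrite big1 ?mul0r ?mulr0 // => r _; rewrite P0 mulr0.
under eq_bigr => a _ do rewrite term0.
(* For [a] nonzero the character is nontrivial on the first coordinate, and [slice_at1] supplies the
   factor [p ^ K]; [al] collects the cofactors. *)
have [al alA E] : exists2 al, al \in Aint &
    \sum_(a < n | a != i0) chi (e ^+ a) 1 (- w) *
      (ev (e ^+ a) 1 P * ev (e ^+ a) 1 (slice Q q)) = (p ^ K)%:R * al.
  elim/big_ind: _ => [|u v [a aA ->] [b bA ->]|a a0].
  - by exists 0; rewrite ?rpred0 ?mulr0.
  - by exists (a + b); rewrite ?rpredD ?mulrDr.
  have := slice_at1 (e ^+ a) q (eX a); case: ifP => [/eqP ea1|_ [al alA ->]].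
    case/negP: a0; apply/eqP/val_inj/eqP => /=; move/eqP: ea1.
    by rewrite -(prim_order_dvd en); apply: contraTT => a0; rewrite gtnNdvd // lt0n.
  exists (chi (e ^+ a) 1 (- w) * al); last by rewrite mulrCA.
  by rewrite rpredM // /chi expr1n mulr1 !rpredX // (Aint_prim_root en).
have := slice_at1 1 q (expr1n _ n); rewrite eqxx => E1.
rewrite (bigD1 i0) //= E expr0 E1 /chi !expr1n !mul1r => eq_c.
(* A zero count would give [n * L + p ^ K * al = 0], that is [n + p * al = 0] after division by
   [L]. *)
rewrite lt0n; apply/negP => /eqP c0; move: eq_c; rewrite c0 mulr0.
have -> : (p ^ K = L * p)%N by rewrite -expnSr prednK.
rewrite !natrM [n%:R * _]mulrC -mulrA -mulrDr => /eqP.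
rewrite mulf_eq0 pnatr_eq0 eqn0Ngt pX_gt0 /= addr_eq0 => /eqP n_al.
(* Being a rational algebraic integer, [al] is an integer, so [p] would divide [n]. *)
have : (p %| n)%C.
  apply/dvdCP; exists (- al); last by apply: etrans n_al _; rewrite mulNr mulrC.
  rewrite rpredN; apply: Cint_rat_Aint alA.
  have -> : al = - (n%:R / p%:R) by rewrite n_al mulNr opprK mulrC mulKf.
  by rewrite rpredN rpred_div ?rpred_nat.
by rewrite dvdC_nat => pn; move: np_coprime; rewrite coprime_sym prime_coprime // pn.
Qed.

(** This is the equality case of the termwise bound [1 <= nrepr g], both sums being [n * L]. *)
Lemma nrepr_eq1 w : nrepr w = 1%N.
Proof.
have : (\sum_(g : Zprod n L) nrepr g = n * L)%N.
  apply/eqP; rewrite -(eqr_nat algC) natr_sum.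
  have := slice_at1 1 q (expr1n _ n); rewrite eqxx -(nrepr_hat1 1 (expr1n _ n)) => <-.
  by apply/eqP/eq_bigr => g _; rewrite /chi !expr1n !mulr1.
have -> : (n * L)%N = \sum_(g : Zprod n L) 1.
  by rewrite sum1_card card_prod !card_ord !prednK // pX_gt0.
move=> sum_nrepr; have [_] := leqif_sum (fun g (_ : true) => leqif_eq (nrepr_gt0 g)).
by rewrite sum_nrepr eqxx => /esym/forallP/(_ w)/eqP.
Qed.

Lemma nrepr_inj (r r' : 'I_p) g g' h h' :
  g \in slice P r -> h \in slice Q q -> g' \in slice P r' -> h' \in slice Q q ->
  g + s r + h = g' + s r' + h' -> [/\ r = r', g = g' & h = h'].
Proof.
move=> gP hQ g'P h'Q gh; have /eqP/cards1P[u uE] := nrepr_eq1 (g + s r + h).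
have: (r, (g, h)) \in [set u] by rewrite -uE inE /= gP hQ eqxx.
have: (r', (g', h')) \in [set u] by rewrite -uE inE /= g'P h'Q gh eqxx.
by rewrite !inE => /eqP <- /eqP[-> -> ->].
Qed.

Lemma nrepr_ex w : exists (r : 'I_p) g h,
  [/\ g \in slice P r, h \in slice Q q & g + s r + h = w].
Proof.
have /card_gt0P[[r [g h]]] : (0 < nrepr w)%N by exact: nrepr_gt0.
by rewrite inE => /and3P[/= gP hQ /eqP gh]; exists r, g, h.
Qed.

(** A common point, added to any element of the nonempty [slice Q q], would have two
    representations. *)
Lemma slices_disjoint (r r' : 'I_p) : r != r' ->
  [disjoint [set g + s r | g in slice P r] & [set g + s r' | g in slice P r']].
Proof.
move=> rr'; have [_ [_ [h [_ hQ _]]]] := nrepr_ex 0.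
rewrite -setI_eq0; apply/eqP/setP => w; rewrite !inE.
apply/negP => /andP[/imsetP[g gP ->] /imsetP[g' g'P gg']].
have [] := nrepr_inj _ _ _ _ _ _ gP hQ g'P hQ (congr1 (+%R^~ h) gg').
by move/eqP: rr'.
Qed.

Lemma slices_tiling :
  tiling (\bigcup_(r < p) [set g + s r | g in slice P r]) (slice Q q).
Proof.
move=> w; have [r [g [h [gP hQ gh]]]] := nrepr_ex w.
exists (g + s r, h); split=> [|[u h'] [/= /bigcupP[r' _ /imsetP[g' g'P ->]] h'Q gh']].
  by split=> //; apply/bigcupP; exists r; last exact: imset_f.
by have [-> -> ->] := nrepr_inj _ _ _ _ _ _ gP hQ g'P h'Q (etrans gh (esym gh')).
Qed.
End Spectrum.

(** * Masks in the quotient rings, and assembly of the result *)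

Lemma ev_translate {R : comNzRingType} {n m : nat} {x t : R} (A : {set Zprod n m}) h :
  (0 < n)%N -> (0 < m)%N -> x ^+ n = 1 -> t ^+ m = 1 ->
  ev x t [set g + h | g in A] = chi x t h * ev x t A.
Proof.
move=> n0 m0 xn tm; rewrite /ev big_imset => [|g g' _ _]; last exact: addIr.
by rewrite mulr_sumr; apply: eq_bigr => g _; rewrite chiD // mulrC.
Qed.

(** [inZp 1] is the class of 1, which is 0 when [m = 1]; then [t = 1] and both sides still agree,
    which covers [K = 1]. *)
Lemma expr_Zmod_int {R : comUnitRingType} {m : nat} {t : R} (z : int) :
  (0 < m)%N -> t ^+ m = 1 -> t ^+ ((inZp 1 *~ z : Zmod m) : nat) = t ^ z.
Proof.
move=> m0 tm.
have expn k : t ^+ ((inZp 1 *+ k : Zmod m) : nat) = t ^+ k.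
  elim: k => [|k IHk]; first by rewrite mulr0n.
  rewrite mulrS expr_ZmodD // IHk exprS; congr (_ * _).
  by rewrite -(prednK m0) in tm; rewrite /= (expr_mod _ tm) expr1.
have expN (a : Zmod m) : t ^+ ((- a)%R : Zmod m) = (t ^+ a)^-1.
  have tU : t ^+ a \is a GRing.unit.
    by apply/unitrPr; exists (t ^+ (- a : Zmod m)); rewrite -expr_ZmodD // subrr.
  by apply: (mulrI tU); rewrite mulrV // -expr_ZmodD // subrr.
by case: z => k; [exact: expn | rewrite NegzE mulrNz expN expn].
Qed.

Lemma to_Zxy_maskpoly (n L : nat) (A : {set Zprod n L}) :
  to_Zxy n L (maskpoly A) = ev (to_Zxy n L 'X) (Zxy_y n L) A.
Proof.
pose pi : {rmorphism {poly {poly int}} -> Zxy n L} := to_Zxy n L.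
exact: (@rmorph_ev {poly {poly int}} (Zxy n L) pi).
Qed.

Lemma Zxy_xX (n L : nat) : to_Zxy n L 'X ^+ n = 1.
Proof.
pose pi : {rmorphism {poly {poly int}} -> Zxy n L} := to_Zxy n L.
rewrite -[LHS](rmorphXn pi) -[RHS](rmorph1 pi).
apply/eqP; rewrite -Quotient.idealrBE inE; apply/boolp.asboolP.
by exists 1, 0; rewrite mul0r addr0 mul1r.
Qed.

Lemma at_y1_maskpoly (n m : nat) (A : {set Zprod n m}) :
  at_y1 (maskpoly A) = ev 'X 1 A.
Proof.
pose at1 : {rmorphism {poly {poly int}} -> {poly int}} := at_y1.
transitivity (ev (at_y1 'X) (at_y1 'Y) A).
  exact: (@rmorph_ev {poly {poly int}} {poly int} at1).
by rewrite /at_y1 map_polyX map_polyC /= /horner_eval hornerX.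
Qed.

Lemma horner_maskpoly (n m : nat) (A : {set Zprod n m}) (x t : algC) :
  (map_poly (map_poly intr) (maskpoly A)).[x, t] = ev x t A.
Proof.
pose u : {rmorphism {poly {poly int}} -> {poly {poly algC}}} :=
  map_poly (map_poly intr).
have -> : map_poly (map_poly intr) (maskpoly A) = ev (u 'X) (u 'Y) A.
  exact: (@rmorph_ev {poly {poly int}} {poly {poly algC}} u).
rewrite /u /= map_polyX map_polyC /= map_polyX !horner_sum.
by apply: eq_bigr => g _; rewrite /chi !hornerE.
Qed.

Lemma ev_bigcup {R : comNzRingType} {n m : nat} {I : finType} (x t : R)
    (A : I -> {set Zprod n m}) :
  (forall i j, i != j -> [disjoint A i & A j]) ->
  ev x t (\bigcup_i A i) = \sum_i ev x t (A i).
Proof. by move=> disjA; apply: partition_disjoint_bigcup. Qed.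
Theorem theorem3p3 (p n K : nat) (P Q : {set Zprod n (p ^ K)})
    (zeta : algC)
    (p_prime : prime p) (n_gt0 : (1 <= n)%N) (K_gt0 : (1 <= K)%N)
    (n_p_coprime : gcdn n p = 1%N)
    (zeta_prim : p.-primitive_root zeta)
    (PQ_tiling : tiling P Q)
    (Q_zeta : (map_poly (map_poly intr) (maskpoly Q)).[1, zeta] = 0) :
  (forall eta : int, exists D : {set Zprod n (p ^ K.-1)},
     [/\ Fmask P eta = to_Zxy n (p ^ K.-1) (maskpoly D),
         forall q : 'I_p, tiling D (slice Q q),
         forall r s : 'I_p, r != s ->
           [disjoint shift_y (slice P r) (eta * r%:Z)
                   & shift_y (slice P s) (eta * s%:Z)]
       & at_y1 (maskpoly D) = at_y1 (maskpoly P) %[ mod_ideal cyc1 n]])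
  /\ at_y1 (maskpoly Q) = \sum_(q < p) at_y1 (maskpoly (slice Q q))
       %[ mod_ideal cyc1 n].
Proof.
have p_gt0 := prime_gt0 p_prime.
have L_gt0 : (0 < p ^ K.-1)%N by rewrite expn_gt0 p_gt0.
have np : coprime n p by rewrite /coprime n_p_coprime.
rewrite horner_maskpoly in Q_zeta.
split=> [eta|]; last first.
  rewrite at_y1_maskpoly ev_slice //; congr (\pi _); apply: eq_bigr => q _.
  by rewrite at_y1_maskpoly !expr1n mul1r.
pose s (r : 'I_p) : Zprod n (p ^ K.-1) := (0, inZp 1 *~ (eta * r%:Z)).
have disj (r r' : 'I_p) : r != r' ->
    [disjoint shift_y (slice P r) (eta * r%:Z) & shift_y (slice P r') (eta * r'%:Z)].
  (* Any [q] would serve as the auxiliary slice of [Q]; 0 is taken. *)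
  exact: (slices_disjoint _ _ _ _ _ _ p_prime n_gt0 K_gt0 np zeta_prim
    PQ_tiling Q_zeta s (fun=> erefl) (Ordinal p_gt0)).
pose D := \bigcup_(r < p) shift_y (slice P r) (eta * r%:Z).
have evD (R : comNzRingType) (x t : R) :
    ev x t D = \sum_(r < p) ev x t (shift_y (slice P r) (eta * r%:Z)).
  exact: ev_bigcup disj.
exists D; split => //.
(* In [Zxy] both variables have the required orders, so translation by [(0, eta * r)] is
   multiplication by that power of [y]. *)
- rewrite to_Zxy_maskpoly evD; apply: eq_bigr => r _.
  rewrite ev_translate ?Zxy_xX ?Zxy_yX // to_Zxy_maskpoly.
  by rewrite /chi expr0 mul1r expr_Zmod_int ?Zxy_yX.
- move=> q; exact: (slices_tiling _ _ _ _ _ _ p_prime n_gt0 K_gt0 np zeta_prim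
    PQ_tiling Q_zeta s (fun=> erefl)).
(* The identity holds already in [{poly int}]: there ['X] has no finite order, but the shift leaves
   first coordinates unchanged, so reindexing suffices. *)
congr (\pi _); rewrite !at_y1_maskpoly evD [RHS]ev_slice //.
apply: eq_bigr => r _; rewrite !expr1n mul1r /ev big_imset => [|g g' _ _]; last exact: addIr.
by apply: eq_bigr => g _; rewrite /chi !expr1n -[in RHS](addr0 g.1).
Qed.
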